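(* Let $\mathcal F$ be a group pair whose index set $I$ is linearly ordered by $<$. Then $\mathcal F$ is a group frame if and only if the following four conditions hold: (i) $\varphi_{xx}$ is the identity automorphism of $G_x/\{e_x\}$ for every $x\in I$; (ii) $\varphi_{yx}=\varphi_{xy}^{-1}$ for every $(x,y)\in\mathcal E$ with $x<y$; (iii) $\varphi_{xy}[H_{xy}\circ H_{xz}]=K_{xy}\circ H_{yz}$ and $\varphi_{yz}[K_{xy}\circ H_{yz}]=K_{xz}\circ K_{yz}$ for all $(x,y),(y,z)\in\mathcal E$ with $x<y<z$; (iv) $\hat\varphi_{xy}\,;\,\hat\varphi_{yz}=\hat\varphi_{xz}$ for all $(x,y),(y,z)\in\mathcal E$ with $x<y<z$. Here $\hat\varphi_{xy},\hat\varphi_{xz}$ are the maps induced by $\varphi_{xy},\varphi_{xz}$ on $G_x/(H_{xy}\circ H_{xz})$, and $\hat\varphi_{yz}$ is the map induced by $\varphi_{yz}$ on $G_y/(K_{xy}\circ H_{yz})$.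
   Context: A group pair consists of the following data. - Pairwise disjoint groups $G_x$ ($x\in I$), with identity $e_x$. - An equivalence relation $\mathcal E$ on $I$. - For each $(x,y)\in\mathcal E$, an isomorphism $\varphi_{xy}:G_x/H_{xy}\to G_y/K_{xy}$, where $H_{xy}\trianglelefteq G_x$ and $K_{xy}\trianglelefteq G_y$. $X\circ Y$ denotes the complex product. For $S$ a union of cosets of $H_{xy}$, $\varphi_{xy}[S]$ is the union of the images of the cosets in $S$. A map induced by $\varphi_{xy}$ on a quotient modulo a normal subgroup $N\supseteq H_{xy}$ sends each coset $C$ of $N$ to $\varphi_{xy}[C]$. The notation $f;g$ means first $f$ then $g$. A group frame is a group pair such that for all $(x,y),(y,z)\in\mathcal E$ (with no ordering restriction): (a) $\varphi_{xx}$ is the identity automorphism of $G_x/\{e_x\}$; (b) $\varphi_{yx}=\varphi_{xy}^{-1}$; (c) $\varphi_{xy}[H_{xy}\circ H_{xz}]=K_{xy}\circ H_{yz}$; (d) $\hat\varphi_{xy};\hat\varphi_{yz}=\hat\varphi_{xz}$, with the induced maps as in (iv). *)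

(* Defs.v *)
From Corelib Require Import RelationClasses.
From mathcomp Require Import all_boot all_order.
From mathcomp Require Import boolp classical_sets functions.

Set Implicit Arguments.
Unset Strict Implicit.
Unset Printing Implicit Defensive.

Local Open Scope classical_set_scope.
Local Open Scope group_scope.

Definition cprod (G : groupType) (X Y : set G) : set G :=
  [set x * y | x in X & y in Y].

Definition normal_subgroup (G : groupType) (N : set G) : Prop :=
  group_closed (mem N) /\ (forall n g : G, N n -> N (n ^ g)).

(* The carrier of G / N; for N normal, the quotient operation on cosets is the
   complex product. *)
Definition cosets (G : groupType) (N : set G) : set (set G) :=
  range (fun g : G => [set g * n | n in N]).

(* A map G / H -> G' / K is encoded as a total function set G -> set G' whose
   values outside [cosets H] are irrelevant. *)
Definition quotient_iso (G G' : groupType) (H : set G) (K : set G')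
    (f : set G -> set G') : Prop :=
  set_bij (cosets H) (cosets K) f /\
  (forall C D : set G, cosets H C -> cosets H D ->
     f (cprod C D) = cprod (f C) (f D)).

Definition coset_image (G G' : groupType) (H : set G) (f : set G -> set G')
    (S : set G) : set G' :=
  \bigcup_(C in [set C | cosets H C /\ C `<=` S]) f C.

(* The partial function with domain A that agrees with f, as a set of pairs. *)
Definition graph_on (T U : Type) (A : set T) (f : T -> U) : set (T * U) :=
  [set p | A p.1 /\ p.2 = f p.1].

Unset Implicit Arguments.
(* The groups are distinct members of a family of types, hence pairwise
   disjoint.  The fields gpH, gpK and gpphi are meaningful only at pairs (x, y)
   with gpE x y; nothing is assumed about them elsewhere. *)
Record group_pair (I : Type) := GroupPair {
  gpG : I -> groupType;
  gpE : I -> I -> Prop;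
  gpH : forall x y : I, set (gpG x);
  gpK : forall x y : I, set (gpG y);
  gpphi : forall x y : I, set (gpG x) -> set (gpG y);
  gpE_equiv : Equivalence gpE;
  gpH_normal : forall x y : I, gpE x y -> normal_subgroup (gpH x y);
  gpK_normal : forall x y : I, gpE x y -> normal_subgroup (gpK x y);
  gpphi_iso : forall x y : I, gpE x y ->
    quotient_iso (gpH x y) (gpK x y) (gpphi x y)
}.

Arguments GroupPair {I}.
Arguments gpG {I}.
Arguments gpE {I}.
Arguments gpH {I}.
Arguments gpK {I}.
Arguments gpphi {I}.
Arguments gpE_equiv {I}.
Arguments gpH_normal {I}.
Arguments gpK_normal {I}.
Arguments gpphi_iso {I}.

Section GroupFrame.
Variables (I : Type) (F : group_pair I).

Definition phi_map (x y : I) : set (set (gpG F x) * set (gpG F y)) :=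
  graph_on (cosets (gpH F x y)) (gpphi F x y).

Definition phi_image (x y : I) (S : set (gpG F x)) : set (gpG F y) :=
  coset_image (gpH F x y) (gpphi F x y) S.

(* The map induced by phi_xy on G_x / N, used for normal N containing H_xy. *)
Definition phi_hat (x y : I) (N : set (gpG F x)) :
    set (set (gpG F x) * set (gpG F y)) :=
  graph_on (cosets N) (phi_image x y).

(* Equality of graphs forces H_xx = K_xx = {e_x}. *)
Definition phi_refl (x : I) : Prop :=
  phi_map x x = graph_on (cosets [set (1 : gpG F x)]) id.

(* Equality of graphs forces H_yx = K_xy and K_yx = H_xy. *)
Definition phi_sym (x y : I) : Prop :=
  phi_map y x = ((phi_map x y)^-1)%relation.

(* The library's [g \; f] relates u to w when f u v and g v w for some v, so it
   is the composition "first f, then g", written f ; g on paper. *)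
Definition phi_comp (x y z : I) : Prop :=
  (phi_hat y z (cprod (gpK F x y) (gpH F y z)) \;
   phi_hat x y (cprod (gpH F x y) (gpH F x z)))%relation
  = phi_hat x z (cprod (gpH F x y) (gpH F x z)).

Definition group_frame : Prop :=
  [/\ forall x, phi_refl x,
      forall x y, gpE F x y -> phi_sym x y,
      forall x y z, gpE F x y -> gpE F y z ->
        phi_image x y (cprod (gpH F x y) (gpH F x z))
        = cprod (gpK F x y) (gpH F y z)
    & forall x y z, gpE F x y -> gpE F y z -> phi_comp x y z].

End GroupFrame.

Arguments phi_map {I}.
Arguments phi_image {I}.
Arguments phi_hat {I}.
Arguments phi_refl {I}.
Arguments phi_sym {I}.
Arguments phi_comp {I}.
Arguments group_frame {I}.

(* Main.v *)
(** By Goursat, phi_xy amounts to the subgroup R_xy of G_x * G_y of the pairs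
    (g, h) with h in phi_xy[g H_xy]; it has full projections and kernels H_xy
    and K_xy.  Conditions (c) and (d) for (x, y, z) together say that
    R_xy ; R_yz = H_xy R_xz.  When R_yx is the converse of R_xy, this passes
    from (x, y, z) to (y, x, z) unconditionally, and to (z, y, x) provided that
    R_yz[K_xy] = K_xz K_yz, the second half of (iii).  That second half in turn
    passes from (x, y, z) to (y, x, z), so every ordering of a triple is reached
    from the increasing one; triples with a repetition are trivial. *)

Require Import Defs.
From Corelib Require Import RelationClasses.
From mathcomp Require Import all_boot all_order.
From mathcomp Require Import boolp classical_sets functions.

Set Implicit Arguments.
Unset Strict Implicit.
Unset Printing Implicit Defensive.

Import Order.TTheory.

Local Open Scope classical_set_scope.
Local Open Scope group_scope.

Definition group_simp (G : groupType) :=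
  (@mulgA G, @mul1g G, @mulg1 G, @mulVg G, @mulgV G, @mulgK G, @mulgVK G,
   @invgM G, @invgK G, @invg1 G).

(** * Goursat relations between groups and the composition law *)

Record goursat (G G' : groupType) (R : G -> G' -> Prop) : Prop := Goursat {
  goursat_total : forall g, exists h, R g h;
  goursat_surj : forall h, exists g, R g h;
  goursat1 : R 1 1;
  goursatM : forall g h g' h', R g h -> R g' h' -> R (g * g') (h * h');
  goursatV : forall g h, R g h -> R g^-1 h^-1
}.

(** This is the identity R_xy ; R_yz = H_xy R_xz for arbitrary relations: [A ; B] agrees with [C] up
    to a factor [m] in the kernel of [A]. *)
Definition comp_rel (G1 G2 G3 : groupType) (A : G1 -> G2 -> Prop)
    (B : G2 -> G3 -> Prop) (C : G1 -> G3 -> Prop) : Prop :=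
  forall g k, (exists2 h, A g h & B h k) <-> (exists2 m, A m 1 & C (g * m) k).

Lemma goursat_inv (G G' : groupType) (R : G -> G' -> Prop) :
  goursat R -> goursat (fun h g => R g h).
Proof. by case=> tot surj R1 RM RV; split=> // *; [apply: RM | apply: RV]. Qed.

Section Relations.
Variables G1 G2 G3 : groupType.
Variables (A : G1 -> G2 -> Prop) (B : G2 -> G3 -> Prop) (C : G1 -> G3 -> Prop).
Hypotheses (gA : goursat A) (gB : goursat B) (gC : goursat C).

(** Two [A]-images of one element differ by an element [n] with [A 1 n]. This turns the kernel
    factor in [G1] into one in [G2]: [n] is the quotient of two images of the same [g]. *)
Lemma comp_rel_swap : comp_rel A B C -> comp_rel (fun h g => A g h) C B.
Proof.
move=> T h k; split=> [[g Agh Cgk]|[n An Bhk]].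
  have /T[h' Agh' Bhk] : exists2 m, A m 1 & C (g * m) k.
    by exists 1; rewrite ?mulg1 //; apply: goursat1.
  exists (h^-1 * h'); last by rewrite !group_simp.
  by have := goursatM gA (goursatV gA Agh) Agh'; rewrite !group_simp.
have [g Agh] := goursat_surj gA h.
have /T[m Am Cgk] : exists2 h', A g h' & B h' k.
  by exists (h * n) => //; have := goursatM gA Agh An; rewrite mulg1.
exists (g * m) => //.
by have := goursatM gA Agh Am; rewrite mulg1.
Qed.

(** The correction by [m] in the kernel of [A] must be traded for one by an element that [B] relates
    to [1]. By [T] at [g = 1], the left side of the second hypothesis is the [C]-image of the kernel
    of [A], so that hypothesis makes the trade possible modulo the elements that [C] relates to
    [1]. *)
Lemma comp_rel_rev :
  comp_rel A B C ->
  (forall k, (exists2 h, A 1 h & B h k)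
             <-> (exists a b, [/\ C 1 a, B 1 b & k = a * b])) ->
  comp_rel (fun k h => B h k) (fun h g => A g h) (fun k g => C g k).
Proof.
move=> T AB k g; split=> [[h Bhk Agh]|[q Bq Cgk]].
  have /T[m Am Cgk] : exists2 h, A g h & B h k by exists h.
  have [k1 Cm] := goursat_total gC m.
  have /T/AB[a [b [Ca Bb k1E]]] : exists2 m, A m 1 & C (1 * m) k1.
    by exists m => //; rewrite mul1g.
  (* [C] relates [g] to [k * k1^-1]; multiplying by [a], which [C] relates to [1], leaves
     [k * b^-1]. *)
  exists b^-1.
    by have := goursatV gB Bb; rewrite !group_simp.
  have := goursatM gC (goursatM gC Cgk (goursatV gC Cm)) Ca.
  by rewrite k1E !group_simp.
have /AB/T[m Am Cm] : exists a b, [/\ C 1 a, B 1 b & q = a * b].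
  by exists 1, q; split; rewrite ?mul1g //; apply: goursat1.
have /T[h Agh Bhk] : exists2 m, A m 1 & C (g * m) k.
  exists m^-1; first by have := goursatV gA Am; rewrite !group_simp.
  rewrite mul1g in Cm.
  by have := goursatM gC Cgk (goursatV gC Cm); rewrite !group_simp.
by exists h.
Qed.

(** Condition (c) is already contained in the composition law. If [C g 1] and [A g h], then some [a]
    with [A 1 a] shares a [B]-image with [h], so [a^-1 * h] lies in the kernel of [B]. The converse
    corrects an [A]-preimage of [a * b] by kernel elements of [A]. *)
Lemma comp_rel_image : comp_rel A B C ->
  forall h, (exists2 g, C g 1 & A g h)
            <-> (exists a b, [/\ A 1 a, B b 1 & h = a * b]).
Proof.
move=> T h; split=> [[g Cg Agh]|[a [b [Aa Bb ->]]]].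
  have [k Bhk] := goursat_total gB h.
  have /T[m Am Cgm] : exists2 h, A g h & B h k by exists h.
  have /T[a Aa Bak] : exists2 m, A m 1 & C (1 * m) k.
    exists m => //.
    by have := goursatM gC (goursatV gC Cg) Cgm; rewrite !group_simp.
  exists a, (a^-1 * h); split=> //; last by rewrite !group_simp.
  by have := goursatM gB (goursatV gB Bak) Bhk; rewrite !group_simp.
have [k Bak] := goursat_total gB a.
have [g Agh] := goursat_surj gA (a * b).
have /T[m Am Cm] : exists2 h, A 1 h & B h k by exists a.
have /T[n An Cgn] : exists2 h, A g h & B h k.
  by exists (a * b) => //; have := goursatM gB Bak Bb; rewrite mulg1.
rewrite mul1g in Cm.
exists (m^-1 * (g * n)).
  by have := goursatM gC (goursatV gC Cm) Cgn; rewrite !group_simp.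
have := goursatM gA (goursatV gA Am) (goursatM gA Agh An).
by rewrite !group_simp.
Qed.

(** The right-hand equivalence is (d) read elementwise on the coset of [g] modulo H_xy H_xz. The
    factor [n] is harmless: [C] absorbs it directly, and by (c) its [A]-images split into a part
    from [1] and a part that [B] absorbs. *)
Lemma comp_relP :
  (forall h, (exists2 g, C g 1 & A g h)
             <-> (exists a b, [/\ A 1 a, B b 1 & h = a * b])) ->
  comp_rel A B C <->
  (forall g k, (exists m n, [/\ A m 1, C n 1 & C (g * (m * n)) k])
     <-> (exists h m n, [/\ A m 1, C n 1, A (g * (m * n)) h & B h k])).
Proof.
move=> AC; split=> [T g k|D g k].
  split=> [[m [n [Am Cn Ck]]]|[h [m [n [Am Cn Ah Bhk]]]]].
    have /T[h Ah Bhk] : exists2 m, A m 1 & C (g * m) k.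
      exists m => //.
      by have := goursatM gC Ck (goursatV gC Cn); rewrite !group_simp.
    exists h, 1, 1; rewrite !mulg1.
    by split=> //; apply: goursat1.
  have /T[p Ap Cp] : exists2 h, A (g * (m * n)) h & B h k by exists h.
  (* Conjugating [p] by [n] puts [n] last, where [C] absorbs it; the kernel of [A] is stable under
     this conjugation, as the [A]-image [v] of [n] shows. *)
  exists (m * n * p * n^-1), 1; split; last 1 first.
  - by have := goursatM gC Cp (goursatV gC Cn); rewrite !group_simp.
  - have [v Anv] := goursat_total gA n.
    have := goursatM gA (goursatM gA (goursatM gA Am Anv) Ap) (goursatV gA Anv).
    by rewrite !group_simp.
  - exact: goursat1.
split=> [[h Agh Bhk]|[m Am Ck]].
  have /D[m [n [Am Cn Ck]]] :
      exists h m n, [/\ A m 1, C n 1, A (g * (m * n)) h & B h k].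
    by exists h, 1, 1; rewrite !mulg1; split=> //; apply: goursat1.
  exists m => //.
  by have := goursatM gC Ck (goursatV gC Cn); rewrite !group_simp.
have /D[h [p [n [Ap Cn Ah Bhk]]]] :
    exists m n, [/\ A m 1, C n 1 & C (g * (m * n)) k].
  by exists m, 1; rewrite mulg1; split=> //; apply: goursat1.
have [u Agu] := goursat_total gA g.
have /AC[a [b [Aa Bb hE]]] : exists2 n, C n 1 & A n (u^-1 * h).
  exists n => //.
  have := goursatM gA (goursatV gA Ap) (goursatM gA (goursatV gA Agu) Ah).
  by rewrite !group_simp.
(* Since [h = u * a * b] with [B b 1], dropping [b] keeps the [B]-image [k] and leaves an [A]-image
   of [g] itself. *)
exists (u * a); first by have := goursatM gA Agu Aa; rewrite mulg1.
have := goursatM gB Bhk (goursatV gB Bb).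
have -> : h = u * a * b by rewrite -mulgA -hE !group_simp.
by rewrite !group_simp.
Qed.

(** This carries the second half of (iii) from (x, y, z) to (y, x, z). By [T] at [g = 1], the
    [C]-image of H_xy is the [B]-image of K_xy; the two factors of the product are then exchanged by
    conjugation, K_xz being normal because [C] is surjective. *)
Lemma comp_rel_image_swap : comp_rel A B C ->
  (forall k, (exists2 h, A 1 h & B h k)
             <-> (exists a b, [/\ C 1 a, B 1 b & k = a * b])) ->
  forall k, (exists2 g, A g 1 & C g k)
            <-> (exists b a, [/\ B 1 b, C 1 a & k = b * a]).
Proof.
move=> T AB k.
have -> : (exists2 g, A g 1 & C g k) <-> (exists2 h, A 1 h & B h k).
  by split=> [[g Ag Cg]|/T[g]]; [apply/T; exists g|exists g];
    rewrite // ?mul1g // -[g]mul1g.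
rewrite AB; split=> [[a [b [Ca Bb ->]]]|[b [a [Bb Ca ->]]]];
  have [u Cub] := goursat_surj gC b.
  exists b, (b^-1 * a * b); split=> //; last by rewrite !group_simp.
  have := goursatM gC (goursatM gC (goursatV gC Cub) Ca) Cub.
  by rewrite !group_simp.
exists (b * a * b^-1), b; split=> //; last by rewrite !group_simp.
have := goursatM gC (goursatM gC Cub Ca) (goursatV gC Cub).
by rewrite !group_simp.
Qed.

End Relations.

(** * Cosets and products of normal subgroups *)

Definition lcoset (G : groupType) (N : set G) (g : G) : set G :=
  [set g * n | n in N].

Section Normal.
Variables (G : groupType) (N : set G).
Hypothesis nN : normal_subgroup N.

Lemma normal1 : N 1.
Proof. by case: nN => -[+ _] _; rewrite inE. Qed.

Lemma normal_div m n : N m -> N n -> N (m * n^-1).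
Proof.
by move=> Nm Nn; case: nN => -[_ /(_ m n)] + _; rewrite !inE; apply.
Qed.

Lemma normalV n : N n -> N n^-1.
Proof. by move=> /(normal_div normal1); rewrite mul1g. Qed.

Lemma normalM m n : N m -> N n -> N (m * n).
Proof. by move=> Nm /normalV/(normal_div Nm); rewrite invgK. Qed.

Lemma normalJ n g : N n -> N (g^-1 * n * g).
Proof. by case: nN => _ /(_ n g); rewrite /conjg mulgA. Qed.

Lemma lcosetP g h : lcoset N g h <-> N (g^-1 * h).
Proof.
split=> [[n Nn <-]|Ngh]; first by rewrite mulKg.
by exists (g^-1 * h); rewrite ?mulVKg.
Qed.

Lemma lcoset_refl g : lcoset N g g.
Proof. by apply/lcosetP; rewrite mulVg; exact: normal1. Qed.

Lemma lcoset_eq g h : lcoset N g h -> lcoset N g = lcoset N h.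
Proof.
move=> /lcosetP Ngh; apply/seteqP; split=> k /lcosetP Nk; apply/lcosetP.
  by have := normalM (normalV Ngh) Nk; rewrite !group_simp.
by have := normalM Ngh Nk; rewrite !group_simp.
Qed.

Lemma lcoset1 : lcoset N 1 = N.
Proof.
by apply/seteqP; split=> k; [move/lcosetP|move=> ?; apply/lcosetP];
  rewrite invg1 mul1g.
Qed.

Lemma cosets_lcoset g : cosets N (lcoset N g).
Proof. by exists g. Qed.

Lemma cosets_eq D h : cosets N D -> D h -> D = lcoset N h.
Proof. by case=> g _ <-; exact: lcoset_eq. Qed.

Lemma cprod_lcoset g h : cprod (lcoset N g) (lcoset N h) = lcoset N (g * h).
Proof.
apply/seteqP; split=> [_ [_ [m Nm <-] [_ [n Nn <-] <-]]|_ [n Nn <-]].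
  apply/lcosetP.
  by have := normalM (normalJ h Nm) Nn; rewrite !group_simp.
exists g; first exact: lcoset_refl.
by exists (h * n); [exists n|rewrite mulgA].
Qed.

End Normal.

Lemma normal_cprod (G : groupType) (M N : set G) :
  normal_subgroup M -> normal_subgroup N -> normal_subgroup (cprod M N).
Proof.
move=> nM nN; split; last first.
  move=> _ g [m Mm [n Nn <-]].
  exists (g^-1 * m * g); first exact: normalJ.
  by exists (g^-1 * n * g); [exact: normalJ|rewrite /conjg !group_simp].
split=> [|x y]; rewrite !inE.
  by exists 1; [exact: normal1|exists 1; [exact: normal1|exact: mulg1]].
move=> [m Mm [n Nn <-]] [p Mp [q Nq <-]].
have Nnq := normal_div nN Nn Nq.
exists (m * p^-1); first exact: normal_div.
exists (p * (n * q^-1) * p^-1); last by rewrite !group_simp.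
by have := normalJ nN p^-1 Nnq; rewrite invgK.
Qed.

Lemma sub_cprodl (G : groupType) (M N : set G) :
  normal_subgroup N -> M `<=` cprod M N.
Proof.
move=> nN m Mm; exists m => //; exists 1; last exact: mulg1.
exact: normal1.
Qed.

Lemma sub_cprodr (G : groupType) (M N : set G) :
  normal_subgroup M -> N `<=` cprod M N.
Proof.
move=> nM n Nn; exists 1; first exact: normal1.
by exists n; rewrite ?mul1g.
Qed.

(** * The Goursat relation of an isomorphism of quotients *)

Definition quotient_rel (G G' : groupType) (H : set G) (f : set G -> set G') :
  G -> G' -> Prop := fun g h => f (lcoset H g) h.

Section QuotientIso.
Variables (G G' : groupType) (H : set G) (K : set G') (f : set G -> set G').
Hypotheses (nH : normal_subgroup H) (nK : normal_subgroup K).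
Hypothesis fiso : quotient_iso H K f.
Local Notation R := (quotient_rel H f).

Lemma quotient_relE g h : R g h <-> f (lcoset H g) = lcoset K h.
Proof.
split=> [Rgh|]; last by rewrite /quotient_rel => ->; exact: lcoset_refl.
apply: cosets_eq => //; case: fiso => -[+ _ _] _; apply.
exact: cosets_lcoset.
Qed.

Lemma quotient_relM g h g' h' : R g h -> R g' h' -> R (g * g') (h * h').
Proof.
move=> /quotient_relE E /quotient_relE E'; apply/quotient_relE.
rewrite -(cprod_lcoset nH) -(cprod_lcoset nK) -E -E'.
by case: fiso => _; apply; exact: cosets_lcoset.
Qed.

Lemma quotient_rel_total g : exists h, R g h.
Proof.
have [[fK _ _] _] := fiso.
have [h _ E] := fK _ (cosets_lcoset H g).
by exists h; apply/quotient_relE; rewrite -E.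
Qed.

Lemma quotient_rel_surj h : exists g, R g h.
Proof.
have [[_ _ fS] _] := fiso.
have [_ [g _ <-] E] := fS _ (cosets_lcoset K h).
by exists g; apply/quotient_relE.
Qed.

(** The coset [f H] is idempotent, hence equal to [K]. *)
Lemma quotient_rel1l k : R 1 k <-> K k.
Proof.
suff E : f (lcoset H 1) = K by rewrite /quotient_rel E.
have [h Rh] := quotient_rel_total 1.
have := quotient_relM Rh Rh; rewrite mulg1 /quotient_rel.
move/quotient_relE: (Rh) => E; rewrite E => /lcosetP.
rewrite mulKg => Kh; rewrite -[RHS](lcoset1 K).
by apply/esym/lcoset_eq => //; apply/lcosetP; rewrite invg1 mul1g.
Qed.

Lemma quotient_rel_goursat : goursat R.
Proof.
have R1 : R 1 1 by apply/quotient_rel1l; exact: normal1.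
split=> //.
- exact: quotient_rel_total.
- exact: quotient_rel_surj.
- exact: quotient_relM.
move=> g h Rgh; have [h' Rgh'] := quotient_rel_total g^-1.
have := quotient_relM Rgh Rgh'; rewrite mulgV => /quotient_rel1l Kh.
(* The image [h'] of [g^-1] is corrected by [(h * h')^-1], an element of [K], to become [h^-1]. *)
have := quotient_relM Rgh' _; move/(_ 1 (h * h')^-1).
rewrite mulg1 !group_simp; apply.
by apply/quotient_rel1l; rewrite -invgM; exact: normalV.
Qed.

Lemma quotient_rel1r g : R g 1 <-> H g.
Proof.
split=> [Rg|Hg]; last first.
  suff -> : R g 1 = R 1 1 by exact: (goursat1 quotient_rel_goursat).
  rewrite /quotient_rel; congr (f _ _); apply/esym/lcoset_eq => //.
  by apply/lcosetP; rewrite invg1 mul1g.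
have [[_ fI _] _] := fiso.
have E : lcoset H g = lcoset H 1.
  apply: fI; rewrite ?inE; try exact: cosets_lcoset.
  move/quotient_relE: Rg => ->; apply/esym/quotient_relE.
  exact: (goursat1 quotient_rel_goursat).
by rewrite -[H](lcoset1 H) -E; exact: lcoset_refl.
Qed.

(** [coset_image] only collects cosets lying inside [S]; saturation of [S] under [H] ensures that
    the coset of each [g] in [S] is among them. *)
Lemma coset_imageP (S : set G) :
  (forall g n, S g -> H n -> S (g * n)) ->
  forall h, coset_image H f S h <-> exists2 g, S g & R g h.
Proof.
move=> SH h; split=> [[_ [[g _ <-] gS] fh]|[g Sg Rgh]].
  by exists g => //; apply: gS; exact: lcoset_refl.
exists (lcoset H g) => //; split; first exact: cosets_lcoset.
by move=> _ [n Hn <-]; exact: SH.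
Qed.

Lemma coset_image_lcoset N g : normal_subgroup N -> H `<=` N ->
  forall h, coset_image H f (lcoset N g) h <-> exists2 n, N n & R (g * n) h.
Proof.
move=> nN HN h; rewrite coset_imageP.
  split=> [[_ [n Nn <-] Rh]|[n Nn Rh]]; first by exists n.
  by exists (g * n) => //; exists n.
move=> _ n' [n Nn <-] Hn'; exists (n * n'); last by rewrite mulgA.
by apply: normalM => //; exact: HN.
Qed.

Lemma coset_imageE N : normal_subgroup N -> H `<=` N ->
  forall h, coset_image H f N h <-> exists2 n, N n & R n h.
Proof.
move=> nN HN h; rewrite -{1}(lcoset1 N) coset_image_lcoset //.
by split=> -[n Nn Rn]; exists n; rewrite ?mul1g // -[n]mul1g.
Qed.

Lemma coset_image_lcosetE N g h : normal_subgroup N -> H `<=` N ->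
  R g h -> coset_image H f (lcoset N g) = lcoset (coset_image H f N) h.
Proof.
have gR := quotient_rel_goursat.
move=> nN HN Rgh; apply/seteqP; split=> [h'|_ [k + <-]].
  move=> /coset_image_lcoset[//|//|n Nn Rh'].
  exists (h^-1 * h'); last by rewrite mulVKg.
  apply/coset_imageE => //; exists n => //.
  by have := goursatM gR (goursatV gR Rgh) Rh'; rewrite !group_simp.
move=> /coset_imageE[//|//|n Nn Rk].
by apply/coset_image_lcoset => //; exists n => //; exact: goursatM.
Qed.

End QuotientIso.

(** Only one inclusion between a relation and the converse of the other; applying it again with the
    two maps exchanged gives equality. *)
Lemma graph_on_rel (G G' : groupType) (H : set G) (K : set G')
    (H' : set G') (f : set G -> set G') (f' : set G' -> set G) :
  normal_subgroup H -> normal_subgroup K -> normal_subgroup H' ->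
  quotient_iso H K f ->
  (graph_on (cosets H') f' = (graph_on (cosets H) f)^-1)%relation ->
  forall g h, quotient_rel H f g h -> quotient_rel H' f' h g.
Proof.
move=> nH nK nH' fi E g h /(quotient_relE nK fi) Rgh.
have : ((graph_on (cosets H) f)^-1)%relation (lcoset K h, lcoset H g).
  by split=> //=; exact: cosets_lcoset.
rewrite -E => -[/= cK E'].
rewrite /quotient_rel -(cosets_eq nH' cK); last exact: lcoset_refl.
by rewrite -E'; exact: lcoset_refl.
Qed.

(** * The relations attached to a group pair *)

Section GroupPair.
Variables (I : Type) (F : group_pair I).

Definition pair_rel (x y : I) : gpG F x -> gpG F y -> Prop :=
  quotient_rel (gpH F x y) (gpphi F x y).

Definition pair_comp (x y z : I) : Prop :=
  comp_rel (@pair_rel x y) (@pair_rel y z) (@pair_rel x z).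

Lemma gpE_refl x : gpE F x x.
Proof. by case: (gpE_equiv F) => r _ _; exact: r. Qed.

Lemma gpE_sym x y : gpE F x y -> gpE F y x.
Proof. by case: (gpE_equiv F) => _ s _; exact: s. Qed.

Lemma gpE_trans x y z : gpE F x y -> gpE F y z -> gpE F x z.
Proof. by case: (gpE_equiv F) => _ _ t; exact: t. Qed.

Lemma pair_rel_goursat x y : gpE F x y -> goursat (@pair_rel x y).
Proof.
by move=> Exy; apply: quotient_rel_goursat (gpphi_iso F x y Exy);
  [exact: gpH_normal|exact: gpK_normal].
Qed.

Lemma gpH_rel x y g : gpE F x y -> gpH F x y g <-> pair_rel g (1 : gpG F y).
Proof.
move=> Exy; apply: iff_sym.
have [nH nK] := (gpH_normal F x y Exy, gpK_normal F x y Exy).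
exact: (quotient_rel1r nH nK (gpphi_iso F x y Exy)).
Qed.

Lemma gpK_rel x y h : gpE F x y -> gpK F x y h <-> pair_rel (1 : gpG F x) h.
Proof.
move=> Exy; apply: iff_sym.
have [nH nK] := (gpH_normal F x y Exy, gpK_normal F x y Exy).
exact: (quotient_rel1l nH nK (gpphi_iso F x y Exy)).
Qed.

Lemma phi_sym_rel x y : gpE F x y -> phi_sym F x y ->
  @pair_rel y x = fun h g => pair_rel g h.
Proof.
move=> Exy S; have Eyx := gpE_sym Exy.
have [nH nK] := (gpH_normal F x y Exy, gpK_normal F x y Exy).
have [nH' nK'] := (gpH_normal F y x Eyx, gpK_normal F y x Eyx).
apply/funext => h; apply/funext => g; apply/propext; split.
  apply: (graph_on_rel nH' nK' nH (gpphi_iso F y x Eyx)).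
  by rewrite -/(phi_map F x y) -/(phi_map F y x) S; apply/seteqP; split=> -[].
exact: (graph_on_rel nH nK nH' (gpphi_iso F x y Exy) S).
Qed.

Lemma phi_sym_sym x y : phi_sym F x y -> phi_sym F y x.
Proof. by rewrite /phi_sym => ->; apply/seteqP; split=> -[]. Qed.

Lemma phi_refl_sym x : phi_refl F x -> phi_sym F x x.
Proof.
rewrite /phi_refl /phi_sym => ->.
by apply/seteqP; split=> -[C D] [/= cC E]; split; rewrite /= -?E // E.
Qed.

Lemma phi_refl_rel x : phi_refl F x ->
  forall g h : gpG F x, pair_rel g h <-> g = h.
Proof.
have gR := pair_rel_goursat (gpE_refl x).
have lc1 (g : gpG F x) : lcoset [set (1 : gpG F x)] g = [set g].
  by apply/seteqP; split=> [_ [_ -> <-]|_ ->]; [|exists 1]; rewrite //= mulg1.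
move=> xr g h; split=> [Rgh|<-].
  have : phi_map F x x (lcoset (gpH F x x) g,
                        gpphi F x x (lcoset (gpH F x x) g)).
    by split=> //; exact: cosets_lcoset.
  rewrite xr => -[/= [g' _]]; rewrite -/(lcoset _ _) lc1 => gE hE.
  move: Rgh; rewrite /pair_rel /quotient_rel hE -gE => ->.
  have := lcoset_refl (gpH_normal F x x (gpE_refl x)) g.
  by rewrite -gE.
have : graph_on (cosets [set (1 : gpG F x)]) id ([set g], [set g]).
  by split=> //; rewrite /= -(lc1 g); exact: cosets_lcoset.
rewrite -xr => -[/= cg E].
rewrite /pair_rel /quotient_rel.
rewrite -(cosets_eq (gpH_normal F x x (gpE_refl x)) cg) //.
by rewrite -E.
Qed.

(** * Conditions (c), (d) and the second half of (iii) for a fixed triple *)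

Section Triple.
Variables x y z : I.
Hypotheses (Exy : gpE F x y) (Eyz : gpE F y z).
Let Exz : gpE F x z := gpE_trans Exy Eyz.
Local Notation A := (@pair_rel x y).
Local Notation B := (@pair_rel y z).
Local Notation C := (@pair_rel x z).
Local Notation N := (cprod (gpH F x y) (gpH F x z)).
Local Notation M := (cprod (gpK F x y) (gpH F y z)).

Let nHxy := gpH_normal F x y Exy.
Let nKxy := gpK_normal F x y Exy.
Let nHyz := gpH_normal F y z Eyz.
Let nKyz := gpK_normal F y z Eyz.
Let nHxz := gpH_normal F x z Exz.
Let nKxz := gpK_normal F x z Exz.
Let nN : normal_subgroup N := normal_cprod nHxy nHxz.
Let nM : normal_subgroup M := normal_cprod nKxy nHyz.
Let subN : gpH F x y `<=` N := sub_cprodl nHxz.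
Let subN' : gpH F x z `<=` N := sub_cprodr nHxy.
Let subM : gpH F y z `<=` M := sub_cprodr nKxy.

(** The factor H_xy of [N] leaves no trace on the right because [A] relates each of its elements to
    [1]. *)
Lemma phi_imageE_first :
  phi_image F x y N = M <->
  (forall h, (exists2 g, C g 1 & A g h)
             <-> (exists a b, [/\ A 1 a, B b 1 & h = a * b])).
Proof.
have gA := pair_rel_goursat Exy.
have imP h : phi_image F x y N h <-> exists2 g, C g 1 & A g h.
  rewrite /phi_image (coset_imageE _ nHxy) //.
  split=> [[_ [m /gpH_rel-/(_ Exy) Am [n /gpH_rel-/(_ Exz) Cn <-]]] Ah|
          [n Cn An]].
    exists n => //.
    by have := goursatM gA (goursatV gA Am) Ah; rewrite !group_simp.
  by exists n => //; apply: subN'; apply/gpH_rel.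
have MP h : M h <-> exists a b, [/\ A 1 a, B b 1 & h = a * b].
  split=> [[a /gpK_rel-/(_ Exy) Aa [b /gpH_rel-/(_ Eyz) Bb <-]]
          |[a [b [Aa Bb ->]]]].
    by exists a, b.
  by exists a; [exact/gpK_rel|exists b => //; exact/gpH_rel].
split=> [E h|E]; first by rewrite -imP -MP E.
by apply/seteqP; split=> h; rewrite imP MP E.
Qed.

Lemma phi_imageE_second :
  phi_image F y z M = cprod (gpK F x z) (gpK F y z) <->
  (forall k, (exists2 h, A 1 h & B h k)
             <-> (exists a b, [/\ C 1 a, B 1 b & k = a * b])).
Proof.
have gB := pair_rel_goursat Eyz.
have imP k : phi_image F y z M k <-> exists2 h, A 1 h & B h k.
  rewrite /phi_image (coset_imageE _ nHyz) //.
  split=> [[_ [m /gpK_rel-/(_ Exy) Am [n /gpH_rel-/(_ Eyz) Bn <-]]] Bk|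
          [h Ah Bh]].
    exists m => //.
    by have := goursatM gB Bk (goursatV gB Bn); rewrite !group_simp.
  by exists h => //; apply: (sub_cprodl nHyz); apply/gpK_rel.
have KP k : cprod (gpK F x z) (gpK F y z) k <->
    exists a b, [/\ C 1 a, B 1 b & k = a * b].
  split=> [[a /gpK_rel-/(_ Exz) Aa [b /gpK_rel-/(_ Eyz) Bb <-]]
          |[a [b [Aa Bb ->]]]].
    by exists a, b.
  by exists a; [exact/gpK_rel|exists b => //; exact/gpK_rel].
split=> [E k|E]; first by rewrite -imP -KP E.
by apply/seteqP; split=> k; rewrite imP KP E.
Qed.

(** The hypothesis makes [phi_image F x y] send cosets of [N] to cosets of [M], so the composite is
    defined on every coset of [N] and equality of graphs reduces to a pointwise comparison. *)
Lemma phi_compE : phi_image F x y N = M ->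
  phi_comp F x y z <->
  (forall g k, (exists m n, [/\ A m 1, C n 1 & C (g * (m * n)) k])
     <-> (exists h m n, [/\ A m 1, C n 1, A (g * (m * n)) h & B h k])).
Proof.
move=> NM.
have imN g h : A g h -> phi_image F x y (lcoset N g) = lcoset M h.
  by rewrite -NM; exact: (coset_image_lcosetE nHxy nKxy (gpphi_iso F x y Exy)).
have cM g : cosets M (phi_image F x y (lcoset N g)).
  have [h Agh] := goursat_total (pair_rel_goursat Exy) g.
  by rewrite (imN _ _ Agh); exact: cosets_lcoset.
have NP n : N n <-> exists p q, [/\ A p 1, C q 1 & n = p * q].
  split=> [[p /gpH_rel-/(_ Exy) Ap [q /gpH_rel-/(_ Exz) Cq <-]]
          |[p [q [Ap Cq ->]]]].
    by exists p, q.
  by exists p; [exact/gpH_rel|exists q => //; exact/gpH_rel].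
have LP g k : phi_image F x z (lcoset N g) k <->
    exists m n, [/\ A m 1, C n 1 & C (g * (m * n)) k].
  rewrite /phi_image (coset_image_lcoset _ nHxz) //.
  split=> [[_ /NP[p [q [Ap Cq ->]]] Ck]
          |[p [q [Ap Cq Ck]]]]; first by exists p, q.
  by exists (p * q) => //; apply/NP; exists p, q.
have RP g k : phi_image F y z (phi_image F x y (lcoset N g)) k <->
    exists h m n, [/\ A m 1, C n 1, A (g * (m * n)) h & B h k].
  have [u Agu] := goursat_total (pair_rel_goursat Exy) g.
  have hP h : phi_image F x y (lcoset N g) h <->
      exists p q, [/\ A p 1, C q 1 & A (g * (p * q)) h].
    rewrite /phi_image (coset_image_lcoset _ nHxy) //.
    split=> [[_ /NP[p [q [Ap Cq ->]]] Ck]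
            |[p [q [Ap Cq Ck]]]]; first by exists p, q.
    by exists (p * q) => //; apply/NP; exists p, q.
  (* The inner image is a coset of [M], which contains H_yz, so it is saturated. *)
  rewrite {1}/phi_image (coset_imageP _ nHyz); last first.
    move=> h n; rewrite (imN _ _ Agu) => -[v Mv <-] Hn.
    by exists (v * n); [apply: normalM => //; exact: subM|rewrite mulgA].
  split=> [[h /hP[p [q [Ap Cq Ah]]] Bhk]|[h [p [q [Ap Cq Ah Bhk]]]]].
    by exists h, p, q.
  by exists h => //; apply/hP; exists p, q.
split=> [c g k|D].
  rewrite -LP -RP.
  have : phi_hat F x z N (lcoset N g, phi_image F x z (lcoset N g)).
    by split=> //; exact: cosets_lcoset.
  by rewrite -c => -[D [/= _ ->] [/= _ ->]].
have E g : phi_image F x z (lcoset N g) =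
    phi_image F y z (phi_image F x y (lcoset N g)).
  by apply/seteqP; split=> k; rewrite LP RP D.
apply/seteqP; split=> -[S T] /=.
  by case=> D' [/= [g _ <-] ->] [/= _ ->]; split;
    rewrite /= -?E //; exact: cosets_lcoset.
case=> /= -[g _ <-] ->; exists (phi_image F x y (lcoset N g)).
  by split=> //; exact: cosets_lcoset.
by split=> //=; exact: E.
Qed.

(** Condition (c) is extracted first, since both translations of (d) presuppose it. *)
Lemma pair_compP :
  pair_comp x y z <-> phi_image F x y N = M /\ phi_comp F x y z.
Proof.
have [gA gB] := (pair_rel_goursat Exy, pair_rel_goursat Eyz).
have gC := pair_rel_goursat Exz.
split=> [T|[NM c]].
  have im := comp_rel_image gA gB gC T; have NM := phi_imageE_first.2 im.
  by split=> //; apply/phi_compE => //; apply/comp_relP.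
by apply/(comp_relP gA gB gC (phi_imageE_first.1 NM)); apply/phi_compE.
Qed.

End Triple.

(** * Permuting the indices of a triple *)

Hypothesis refl : forall x, phi_refl F x.
Hypothesis sym : forall x y, gpE F x y -> phi_sym F x y.

Lemma pair_relC x y : gpE F x y ->
  @pair_rel y x = (fun h g => pair_rel g h).
Proof. by move=> Exy; exact: phi_sym_rel (sym Exy). Qed.

Lemma pair_comp_xxz x z : gpE F x z -> pair_comp x x z.
Proof.
move=> Exz g k; split=> [[h /phi_refl_rel-/(_ (refl x)) <- Ck]|].
  by exists 1; [exact/phi_refl_rel|rewrite mulg1].
case=> m /phi_refl_rel-/(_ (refl x)) ->; rewrite mulg1 => Ck.
by exists g => //; exact/phi_refl_rel.
Qed.

Lemma pair_comp_xzz x z : gpE F x z -> pair_comp x z z.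
Proof.
move=> Exz; have gC := pair_rel_goursat Exz.
move=> g k; split=> [[h Ch /phi_refl_rel-/(_ (refl z)) <-]|[m Cm Ck]].
  by exists 1; [exact: goursat1|rewrite mulg1].
exists k; last exact/phi_refl_rel.
by have := goursatM gC Ck (goursatV gC Cm); rewrite !group_simp.
Qed.

Lemma pair_comp_xyx x y : gpE F x y -> pair_comp x y x.
Proof.
move=> Exy; have gA := pair_rel_goursat Exy.
move=> g k; rewrite (pair_relC Exy); split=> [[h Ah Akh]|].
  exists (g^-1 * k); last by apply/phi_refl_rel => //; rewrite mulVKg.
  by have := goursatM gA (goursatV gA Ah) Akh; rewrite !group_simp.
case=> m Am /phi_refl_rel-/(_ (refl x)) <-.
have [h Ah] := goursat_total gA g.
by exists h => //; have := goursatM gA Ah Am; rewrite mulg1.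
Qed.

Lemma pair_comp_swap x y z : gpE F x y -> gpE F y z ->
  pair_comp x y z -> pair_comp y x z.
Proof.
move=> Exy Eyz; rewrite /pair_comp (pair_relC Exy).
by apply: comp_rel_swap; exact: pair_rel_goursat.
Qed.

Lemma pair_comp_rev x y z : gpE F x y -> gpE F y z ->
  pair_comp x y z ->
  phi_image F y z (cprod (gpK F x y) (gpH F y z))
    = cprod (gpK F x z) (gpK F y z) ->
  pair_comp z y x.
Proof.
move=> Exy Eyz T /(phi_imageE_second Exy Eyz); have Exz := gpE_trans Exy Eyz.
rewrite /pair_comp (pair_relC Exy) (pair_relC Eyz) (pair_relC Exz).
by apply: comp_rel_rev => //; exact: pair_rel_goursat.
Qed.

Lemma phi_image_second_swap x y z : gpE F x y -> gpE F y z ->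
  pair_comp x y z ->
  phi_image F y z (cprod (gpK F x y) (gpH F y z))
    = cprod (gpK F x z) (gpK F y z) ->
  phi_image F x z (cprod (gpK F y x) (gpH F x z))
    = cprod (gpK F y z) (gpK F x z).
Proof.
move=> Exy Eyz T /(phi_imageE_second Exy Eyz) AB.
have Exz := gpE_trans Exy Eyz.
apply/(phi_imageE_second (gpE_sym Exy) Exz); rewrite (pair_relC Exy).
by apply: comp_rel_image_swap AB => //; exact: pair_rel_goursat.
Qed.

(** This is (c) for the reversed triple: it says that the R_yz-preimage of K_xz is H_yz K_xy, and
    applying φ_yz yields the claim. *)
Lemma phi_image_second x y z : gpE F x y -> gpE F y z ->
  pair_comp z y x ->
  phi_image F y z (cprod (gpK F x y) (gpH F y z))
    = cprod (gpK F x z) (gpK F y z).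
Proof.
move=> Exy Eyz; have Exz := gpE_trans Exy Eyz.
have [gA gB] := (pair_rel_goursat Exy, pair_rel_goursat Eyz).
have gC := pair_rel_goursat Exz.
rewrite /pair_comp (pair_relC Exy) (pair_relC Eyz) (pair_relC Exz) => T.
have im := comp_rel_image (goursat_inv gB) (goursat_inv gA) (goursat_inv gC) T.
apply/(phi_imageE_second Exy Eyz) => k; split=> [[h Ah Bk]|[a [b [Ca Bb ->]]]].
  have /im[a Ca Ba] : exists a b,
      [/\ pair_rel a (1 : gpG F z), pair_rel (1 : gpG F x) b & h = a * b].
    by exists 1, h; rewrite mul1g; split=> //; exact: goursat1.
  exists a, (a^-1 * k); split=> //; last by rewrite mulVKg.
  by have := goursatM gB (goursatV gB Ba) Bk; rewrite !group_simp.
have [h Bh] := goursat_surj gB a.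
have /im[p [q [Bp Aq hE]]] :
    exists2 k : gpG F z, pair_rel (1 : gpG F x) k & pair_rel h k by exists a.
(* [B] relates [h = p * q] to [a] and [p] to [1], so it relates [q] to [a]. *)
exists q => //.
have := goursatM gB (goursatM gB (goursatV gB Bp) Bh) Bb.
by rewrite hE !group_simp.
Qed.

End GroupPair.

(** * Reduction to increasing triples *)

Section OrderedIndices.
Variables (d : Order.disp_t) (I : orderType d) (F : group_pair I).

Lemma pair_comp_ordered :
  (forall x, phi_refl F x) ->
  (forall x y, gpE F x y -> phi_sym F x y) ->
  (forall x y z : I, gpE F x y -> gpE F y z -> (x < y)%O -> (y < z)%O ->
     pair_comp F x y z /\
     phi_image F y z (cprod (gpK F x y) (gpH F y z))
       = cprod (gpK F x z) (gpK F y z)) ->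
  forall x y z, gpE F x y -> gpE F y z -> pair_comp F x y z.
Proof.
move=> refl sym ordered.
have swap := pair_comp_swap sym.
(* Swapping the first two indices groups the six orderings into three pairs; one ordering from each
   pair is established here. *)
have increasing x y z (Exy : gpE F x y) (Eyz : gpE F y z)
    (xy : (x < y)%O) (yz : (y < z)%O) :
    [/\ pair_comp F x y z, pair_comp F z y x & pair_comp F z x y].
  have [T E] := ordered x y z Exy Eyz xy yz.
  have Exz := gpE_trans Exy Eyz.
  split=> //; first exact: (pair_comp_rev sym).
  (* The ordering (z, x, y) is the reversal of (y, x, z), to which both the composition law and the
     second half of (iii) have been carried. *)
  apply: (pair_comp_rev sym (gpE_sym Exy) Exz); first exact: swap.
  exact: (phi_image_second_swap sym).
move=> x y z Exy Eyz; have Exz := gpE_trans Exy Eyz.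
have [[Eyx Ezy] Ezx] := (gpE_sym Exy, gpE_sym Eyz, gpE_sym Exz).
case: (ltgtP x y) => [xy|yx|<-]; last exact: pair_comp_xxz.
  case: (ltgtP y z) => [yz|zy|<-]; last exact: pair_comp_xzz.
    by have [] := increasing x y z Exy Eyz xy yz.
  case: (ltgtP x z) => [xz|zx|<-]; last exact: pair_comp_xyx.
    have [_ _ T] := increasing x z y Exz Ezy xz zy.
    exact: swap.
  have [_ T _] := increasing z x y Ezx Exy zx xy.
  exact: swap.
case: (ltgtP y z) => [yz|zy|<-]; last exact: pair_comp_xzz.
  case: (ltgtP x z) => [xz|zx|<-]; last exact: pair_comp_xyx.
    have [T _ _] := increasing y x z Eyx Exz yx xz.
    exact: swap.
  by have [_ _ T] := increasing y z x Eyz Ezx yz zx.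
by have [_ T _] := increasing z y x Ezy Eyx zy yx.
Qed.

End OrderedIndices.

Theorem theorem4p4 (d : Order.disp_t) (I : orderType d) (F : group_pair I) :
  group_frame F <->
  [/\ forall x : I, phi_refl F x,
      forall x y : I, gpE F x y -> (x < y)%O -> phi_sym F x y,
      forall x y z : I, gpE F x y -> gpE F y z -> (x < y)%O -> (y < z)%O ->
        phi_image F x y (cprod (gpH F x y) (gpH F x z))
          = cprod (gpK F x y) (gpH F y z) /\
        phi_image F y z (cprod (gpK F x y) (gpH F y z))
          = cprod (gpK F x z) (gpK F y z)
    & forall x y z : I, gpE F x y -> gpE F y z -> (x < y)%O -> (y < z)%O ->
        phi_comp F x y z].
Proof.
split=> [[refl sym im comp]|[refl sym_lt im comp]].
  split=> // [x y Exy _|x y z Exy Eyz _ _|x y z Exy Eyz _ _];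
    [exact: sym| |exact: comp].
  split; first exact: im.
  (* Here (c) and (d) are used at the decreasing triple (z, y, x), available because a frame imposes
     no order. *)
  apply: phi_image_second => //.
  have [Eyx Ezy] := (gpE_sym Exy, gpE_sym Eyz).
  by apply/pair_compP => //; split; [exact: im|exact: comp].
have sym x y : gpE F x y -> phi_sym F x y.
  move=> Exy; case: (ltgtP x y) => [|yx|<-]; first exact: sym_lt.
    by apply: phi_sym_sym; apply: sym_lt => //; exact: gpE_sym.
  exact: phi_refl_sym.
have all_comp x y z : gpE F x y -> gpE F y z -> pair_comp F x y z.
  apply: pair_comp_ordered => // {}x {}y {}z Exy Eyz xy yz.
  have [im1 im2] := im x y z Exy Eyz xy yz; split=> //.
  by apply/pair_compP => //; split=> //; exact: comp.
by split=> // x y z Exy Eyz;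
  have [] := (pair_compP Exy Eyz).1 (all_comp x y z Exy Eyz).
Qed.
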